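(* Let $\mathcal{M}$ be a monotonic collective decision-making model on a finite set of actors $V$, and let $\Gamma_{\mathcal{M}}$ be its associated simple game. Then for every $i\in V$, $\mathrm{Sat}_{\mathcal{M}}(i)=\mathrm{Rae}_{\Gamma_{\mathcal{M}}}(i)$.
   Context: A collective decision-making model $\mathcal{M}$ on a set $V$ of $n$ actors has a collective decision function $C_{\mathcal{M}}:\{0,1\}^n\to\{0,1\}$ (vectors indexed by $V$). For $X\subseteq V$, $x(X)\in\{0,1\}^n$ is the indicator vector of $X$. $\mathcal{M}$ is monotonic if $X\subseteq X'\subseteq V$ implies $C_{\mathcal{M}}(x(X))\le C_{\mathcal{M}}(x(X'))$. For a monotonic $\mathcal{M}$, $\Gamma_{\mathcal{M}}=(V,\mathcal{W})$ is the simple game with $\mathcal{W}=\{X\subseteq V\mid C_{\mathcal{M}}(x(X))=1\}$. The satisfaction is $\mathrm{Sat}_{\mathcal{M}}(i)=|\{x\in\{0,1\}^n\mid C_{\mathcal{M}}(x)=x_i\}|$. The Rae index of player $i$ in a simple game $\Gamma=(V,\mathcal{W})$ is $\mathrm{Rae}_\Gamma(i)=|\{X\in\mathcal{W}\mid i\in X\}|+|\{X\notin\mathcal{W}\mid i\notin X\}|$, with $X$ ranging over subsets of $V$. *)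

(* Defs.v *)
From mathcomp Require Import all_boot.

Set Implicit Arguments.
Unset Strict Implicit.
Unset Printing Implicit Defensive.

(* {0,1} is [bool], so {0,1}^n with coordinates indexed by V is
   [{ffun V -> bool}], and n is #|V|. *)
Record decision_model (V : finType) := DecisionModel {
  decision : {ffun V -> bool} -> bool
}.

Definition indicator (V : finType) (X : {set V}) : {ffun V -> bool} :=
  [ffun v => v \in X].

(* Both sides of [<=] are booleans, coerced to nat. *)
Definition monotonic_model (V : finType) (M : decision_model V) : Prop :=
  forall X X' : {set V}, X \subset X' ->
    decision M (indicator X) <= decision M (indicator X').

(* Upward closure is part of the notion of a simple game; the empty coalition
   may win and the grand coalition may lose. *)
Record simple_game (V : finType) := SimpleGame {
  winning : {set {set V}};
  winning_up : forall X X' : {set V},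
    X \subset X' -> X \in winning -> X' \in winning
}.

Definition model_winning (V : finType) (M : decision_model V) : {set {set V}} :=
  [set X | decision M (indicator X) == true].

Lemma model_winning_up (V : finType) (M : decision_model V) :
  monotonic_model M ->
  forall X X' : {set V},
    X \subset X' -> X \in model_winning M -> X' \in model_winning M.
Proof.
move=> mM X X' /mM; rewrite !inE.
by case: (decision M (indicator X)); case: (decision M (indicator X')).
Qed.

Definition game_of (V : finType) (M : decision_model V)
    (mM : monotonic_model M) : simple_game V :=
  SimpleGame (model_winning_up mM).

Definition Sat (V : finType) (M : decision_model V) (i : V) : nat :=
  #|[set x : {ffun V -> bool} | decision M x == x i]|.

Definition Rae (V : finType) (G : simple_game V) (i : V) : nat :=
  #|[set X in winning G | i \in X]|
  + #|[set X : {set V} | (X \notin winning G) && (i \notin X)]|.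

(* Main.v *)
Require Import Defs.
From mathcomp Require Import all_boot.

(** Vectors correspond to coalitions via the bijection [indicator], so [Sat] counts the coalitions
    [X] on which the decision equals the truth value of [i \in X]. For [X] containing [i] this
    agreement means that [X] wins, for the others that it loses: these are the two terms of
    [Rae]. *)

Lemma indicator_bij (V : finType) : bijective (@indicator V).
Proof.
exists (fun x : {ffun V -> bool} => [set v | x v]) => [X | x].
  by apply/setP=> v; rewrite inE ffunE.
by apply/ffunP=> v; rewrite ffunE inE.
Qed.

Theorem lemma1 (V : finType) (M : decision_model V) (mM : monotonic_model M)
    (i : V) :
  Sat M i = Rae (game_of mM) i.
Proof.
rewrite /Sat -(on_card_preimset (onW_bij _ (indicator_bij V))).
(* Splitting on [i \in X] matches the summands of [Rae] in order. *)
rewrite -(cardsID [set X : {set V} | i \in X]) /Rae.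
by congr (_ + _); apply: eq_card => X; rewrite !inE ffunE;
  case: (i \in X); case: (decision M _).
Qed.
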